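(* For every integer $n \geq 2$, $$(1-o(1))\cdot \frac{n}{\log n} \;\leq\; \operatorname{ldim}(\mathcal{B}_n^1) \;\leq\; 2\cdot\frac{n}{\log n}+3,$$ where $\log$ is the logarithm to base $2$ and $o(1)$ denotes some function of $n$ that tends to $0$ as $n\to\infty$.
   Context: A poset is a pair $P=(X,\leq)$ where $X$ is a non-empty set and $\leq$ is a reflexive, antisymmetric, transitive relation on $X$. A poset $Q$ is a subposet of $P$ if the ground set of $Q$ is a subset of that of $P$ and the order of $Q$ is the restriction of the order of $P$. A linear extension of $P$ is a linear order $L$ on the ground set of $P$ such that $x\leq_L y$ whenever $x\leq_P y$. A partial linear extension of $P$ is a linear extension of a subposet of $P$. A local realizer of $P$ is a family $\mathcal{L}$ of partial linear extensions of $P$ such that for all $x,y\in P$ there exists $L\in\mathcal{L}$ with $x,y\in L$, and $x\leq_P y$ if and only if there is no $L\in\mathcal{L}$ with $y<_L x$. The frequency of an element $x\in P$ in $\mathcal{L}$ is the number of $L\in\mathcal{L}$ with $x\in L$ (i.e. $x$ is in the ground set of $L$); the frequency of $\mathcal{L}$ is the maximum frequency of an element of $P$ in $\mathcal{L}$. The local dimension $\operatorname{ldim}(P)$ is the minimum frequency of a local realizer of $P$. For a positive integer $n$, $\mathcal{B}_n^1$ is the poset on all nonempty subsets of $[n]=\{1,\dots,n\}$ in which $A\leq B$ if and only if $A=B$, or $|A|=1$ and $A\subseteq B$. *)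

(* Defs.v *)
From HB Require Import structures.
From mathcomp Require Import all_boot all_order all_algebra.
From mathcomp Require Import boolp reals exp.

Set Implicit Arguments.
Unset Strict Implicit.
Unset Printing Implicit Defensive.

Import Order.TTheory GRing.Theory Num.Theory.

(* [ple_le] is a relation on all of [T] that never holds outside the ground   *)
(* set; ground sets are non-empty because posets are non-empty by convention. *)
Record partial_linext (d : Order.disp_t) (T : finPOrderType d) := PartialLinext {
  ground : {set T};
  ple_le : rel T;
  ground_neq0 : ground != set0;
  ple_le_ground : forall x y, ple_le x y -> x \in ground /\ y \in ground;
  ple_le_refl : forall x, x \in ground -> ple_le x x;
  ple_le_anti : forall x y, ple_le x y -> ple_le y x -> x = y;
  ple_le_trans : forall x y z, ple_le x y -> ple_le y z -> ple_le x z;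
  ple_le_total : forall x y, x \in ground -> y \in ground ->
    ple_le x y || ple_le y x;
  ple_le_ext : forall x y, x \in ground -> y \in ground ->
    (x <= y)%O -> ple_le x y
}.

Definition ple_lt (d : Order.disp_t) (T : finPOrderType d)
    (L : partial_linext T) (x y : T) : bool :=
  (x != y) && ple_le L x y.

(* Families are indexed by a finite type, so repetitions are allowed. Since T *)
(* is finite and ground sets are non-empty, an infinite family has an element *)
(* of infinite frequency, so finite families suffice to define [ldim].        *)
Definition local_realizer (d : Order.disp_t) (T : finPOrderType d)
    (I : finType) (F : I -> partial_linext T) : Prop :=
  forall x y : T,
    (exists i, x \in ground (F i) /\ y \in ground (F i)) /\
    ((x <= y)%O <-> ~ exists i, ple_lt (F i) y x).

Definition elt_frequency (d : Order.disp_t) (T : finPOrderType d)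
    (I : finType) (F : I -> partial_linext T) (x : T) : nat :=
  #|[set i | x \in ground (F i)]|.

Definition frequency (d : Order.disp_t) (T : finPOrderType d)
    (I : finType) (F : I -> partial_linext T) : nat :=
  \max_(x : T) elt_frequency F x.

Definition is_realizer_frequency (d : Order.disp_t) (T : finPOrderType d)
    (k : nat) : Prop :=
  exists (I : finType) (F : I -> partial_linext T),
    local_realizer F /\ frequency F = k.

(* The one- or two-element chain on {x, y}, with x below y iff x <= y. *)
Lemma pair_linext (d : Order.disp_t) (T : finPOrderType d) (x y : T) :
  {L : partial_linext T | ground L = [set x; y] &
     ~~ (x <= y)%O -> ple_lt L y x}.
Proof.
pose a := if (x <= y)%O then x else y.
pose b := if (x <= y)%O then y else x.
have Hba : (b <= a)%O -> a = b.
  rewrite /a /b; case: ifPn => xy yx; last by rewrite yx in xy.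
  by apply: le_anti; rewrite xy yx.
have Hg z : (z \in [set x; y]) = (z == a) || (z == b).
  by rewrite !inE /a /b; case: ifP => // _; rewrite orbC.
pose r : rel T := fun u v =>
  [|| (u == a) && (v == a), (u == a) && (v == b) | (u == b) && (v == b)].
have Hr1 u v : r u v -> u \in [set x; y] /\ v \in [set x; y].
  by rewrite !Hg /r => /or3P[] /andP[/eqP-> /eqP->]; rewrite !eqxx ?orbT.
have Hne : [set x; y] != set0 :> {set T}.
  by apply/set0Pn; exists x; rewrite !inE eqxx.
have Hr2 u : u \in [set x; y] -> r u u.
  by rewrite Hg /r => /orP[] /eqP->; rewrite !eqxx ?orbT.
have Hr3 u v : r u v -> r v u -> u = v.
  rewrite /r => /or3P[] /andP[/eqP-> /eqP->] //.
  by case/or3P => /andP[/eqP e1 /eqP e2]; rewrite ?e1 ?e2.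
have Hr4 u v w : r u v -> r v w -> r u w.
  rewrite /r => /or3P[] /andP[/eqP-> /eqP->];
  by case/or3P => /andP[/eqP e1 /eqP->]; rewrite ?e1 ?eqxx ?orbT.
have Hr5 u v : u \in [set x; y] -> v \in [set x; y] -> r u v || r v u.
  by rewrite !Hg /r => /orP[] /eqP-> /orP[] /eqP->; rewrite !eqxx ?orbT.
have Hr6 u v : u \in [set x; y] -> v \in [set x; y] -> (u <= v)%O -> r u v.
  rewrite !Hg /r => /orP[] /eqP-> /orP[] /eqP->; rewrite ?eqxx ?orbT //.
  by move=> /Hba ->; rewrite !eqxx.
exists (PartialLinext Hne Hr1 Hr2 Hr3 Hr4 Hr5 Hr6) => // nxy.
rewrite /ple_lt /= /r /a /b (negbTE nxy) !eqxx orbT andbT.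
by apply: contraNneq nxy => ->.
Qed.

Lemma realizer_frequency_ex (d : Order.disp_t) (T : finPOrderType d) :
  exists k, `[< is_realizer_frequency T k >].
Proof.
pose F (p : T * T) := s2val (pair_linext p.1 p.2).
exists (frequency F); apply/asboolP; exists (T * T)%type, F; split=> // x y.
split.
  by exists (x, y); rewrite /F (s2valP (pair_linext x y)) !inE !eqxx orbT.
split=> [xy [p /andP[yx lep]]|H].
  have [yg xg] := ple_le_ground lep.
  by move/eqP: yx; apply; apply: (ple_le_anti lep); exact: ple_le_ext.
apply/negPn/negP => nxy; apply: H; exists (x, y).
exact: (s2valP' (pair_linext x y)).
Qed.

Definition ldim (d : Order.disp_t) (T : finPOrderType d) : nat :=
  ex_minn (realizer_frequency_ex T).

Record Bn1 (n : nat) := MkBn1 {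
  Bn1_set :> {set 'I_n};
  Bn1_neq0 : Bn1_set != set0
}.

HB.instance Definition _ n := [isSub for @Bn1_set n].
HB.instance Definition _ n := [Finite of Bn1 n by <:].

Definition Bn1_le (n : nat) (A B : Bn1 n) : bool :=
  (A == B) || (#|A| == 1) && (A \subset B).

Lemma Bn1_le_refl n : reflexive (@Bn1_le n).
Proof. by move=> A; rewrite /Bn1_le eqxx. Qed.

Lemma Bn1_le_anti n : antisymmetric (@Bn1_le n).
Proof.
move=> A B /andP[/orP[/eqP//|/andP[_ AB]] /orP[/eqP//|/andP[_ BA]]].
by apply: val_inj; apply/eqP; rewrite eqEsubset AB BA.
Qed.

Lemma Bn1_le_trans n : transitive (@Bn1_le n).
Proof.
move=> B A C /orP[/eqP-> //|/andP[A1 AB]] /orP[/eqP<-|/andP[_ BC]];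
by rewrite /Bn1_le A1 ?AB ?(subset_trans AB BC) orbT.
Qed.

Fact Bn1_display : Order.disp_t. Proof. exact: (Order.Disp tt tt). Qed.

HB.instance Definition _ n := Order.Le_isPOrder.Build Bn1_display (Bn1 n)
  (@Bn1_le_refl n) (@Bn1_le_anti n) (@Bn1_le_trans n).

Definition log2 (R : realType) (x : R) : R := (ln x / ln 2)%R.

(* Main.v *)
Require Import Defs.
From HB Require Import structures.
From mathcomp Require Import all_boot all_order all_algebra.
From mathcomp Require Import all_classical all_reals all_analysis.
From mathcomp Require Import fintype finset zify ring lra.

Set Implicit Arguments.
Unset Strict Implicit.
Unset Printing Implicit Defensive.

Import Order.TTheory GRing.Theory Num.Theory.
Import numFieldNormedType.Exports.

(** Write atoms for the singletons. The order of B_n^1 only compares an atom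
    {a} with the sets containing a, so a realizer must, for every A and every
    a outside A, put A below {a} in some partial linear extension; everything
    else is cheap.

    Upper bound. Cut [n] into blocks of k consecutive elements. For a block D
    and a proper subset X of D, one extension lists the atoms in X, then all
    non-atoms A with A :&: D = X, then the atoms in D :\: X. For a in D outside
    a non-atom A, the extension for X = A :&: D puts A below {a}. A non-atom
    lies in one such extension per block, at most n %/ k + 1 of them, and an
    atom in at most 2 ^ k - 1. Two linear extensions of the whole poset, with
    the atoms first and opposite orders inside both levels, reverse all other
    incomparable pairs ([ldim_Bn1_le]). The choice k = ceil (m / 2), where
    2 ^ m is the least power of 2 that is at least n, makes both frequencies
    at most 2 n / log n + 3 ([ldim_Bn1_le_log]).

    Lower bound. In a realizer of frequency t, mark for every extension
    containing A the least atom above A, if there is one. The atoms above A in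
    that extension are those from the mark on, and the elements outside A are
    those whose atom is above A in some extension, so the marks determine A
    ([code_inj]). They form a subset of size at most t of the set of pairs
    (atom, extension containing it), which has size at most n t. There are at
    most (e n) ^ t such subsets ([card_small_subsets]), so
    2 ^ n - 1 <= (e n) ^ t; taking logarithms gives
    t >= (n - 1) ln 2 / (ln n + 1), which is (1 - o(1)) n / log n. *)

(** * Realizers from rank functions *)

(** A local realizer given by injective ranks: extension j orders its ground
    set G j by rk j. Empty ground sets are allowed here, and discarded in the
    proof. *)
Lemma ldim_le_of_ranks (d : Order.disp_t) (T : finPOrderType d) (J : finType)
    (G : J -> {set T}) (rk : J -> T -> nat) (t : nat) :
    (forall j, injective (rk j)) ->
    (forall j, {in G j &, forall x y, (x <= y)%O -> rk j x <= rk j y}) ->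
    (forall x y, exists j, x \in G j /\ y \in G j) ->
    (forall x y, ~~ (x <= y)%O ->
       exists j, [/\ x \in G j, y \in G j & rk j y < rk j x]) ->
    (forall x, #|[set j | x \in G j]| <= t) ->
  ldim T <= t.
Proof.
move=> rk_inj rk_mono G_pair G_rev G_freq.
pose r j : rel T := fun x y => [&& x \in G j, y \in G j & rk j x <= rk j y].
have r_ground j x y : r j x y -> x \in G j /\ y \in G j by case/and3P.
have r_refl j x : x \in G j -> r j x x by rewrite /r => ->; rewrite leqnn.
have r_anti j x y : r j x y -> r j y x -> x = y.
  move=> /and3P[_ _ xy] /and3P[_ _ yx].
  by apply: (rk_inj j); apply/eqP; rewrite eqn_leq xy.
have r_trans j x y z : r j x y -> r j y z -> r j x z.
  move=> /and3P[xG _ xy] /and3P[_ zG yz].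
  by rewrite /r xG zG (leq_trans xy yz).
have r_total j x y : x \in G j -> y \in G j -> r j x y || r j y x.
  by rewrite /r => -> ->; exact: leq_total.
have r_ext j x y : x \in G j -> y \in G j -> (x <= y)%O -> r j x y.
  by rewrite /r => xG yG xy; rewrite xG yG rk_mono.
pose I := {j : J | G j != set0}.
pose F (i : I) := PartialLinext (valP i) (@r_ground (val i)) (@r_refl (val i))
  (@r_anti (val i)) (@r_trans (val i)) (@r_total (val i)) (@r_ext (val i)).
have lift_index j x : x \in G j -> exists i : I, val i = j.
  move=> xG; have G0 : G j != set0 by apply/set0Pn; exists x.
  by exists (exist _ j G0).
have F_real : local_realizer F.
  move=> x y; split.
    have [j [xG yG]] := G_pair x y; have [i ij] := lift_index j x xG.
    by exists i; rewrite /= ij.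
  split=> [xy [i /andP[yx /and3P[yG xG rk_yx]]]|nrev].
    case/negP: yx; apply/eqP/(rk_inj (val i))/eqP.
    by rewrite eqn_leq rk_yx rk_mono.
  apply/negPn/negP => /G_rev[j [xG yG rk_yx]]; apply: nrev.
  have [i ij] := lift_index j x xG; exists i.
  rewrite /ple_lt /= /r ij xG yG (ltnW rk_yx) !andbT.
  by apply: contraTneq rk_yx => ->; rewrite ltnn.
apply: (@leq_trans (frequency F)).
  rewrite /ldim; case: ex_minnP => m _; apply.
  by apply/boolp.asboolP; exists I, F.
apply/bigmax_leqP => x _; apply: leq_trans (G_freq x).
rewrite /elt_frequency -(card_imset _ val_inj) subset_leq_card //.
by apply/subsetP => j /imsetP[i]; rewrite !inE => xi ->.
Qed.

(** Ranks that sort by a level first; inside a level the tie-breaks for the two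
    values of b are opposite, so that together they reverse every pair of
    elements of equal level. *)
Section Lexicographic.
Variables (T : finType) (lev : T -> nat) (b : bool).

Definition tiebreak (x : T) : 'I_#|T| :=
  if b then enum_rank x else rev_ord (enum_rank x).

Definition lexrank (x : T) : nat := lev x * #|T| + tiebreak x.

Lemma lexrank_lt x y : lev x < lev y -> lexrank x < lexrank y.
Proof.
move=> xy; rewrite /lexrank; have := ltn_ord (tiebreak x).
move: (tiebreak x) (tiebreak y) => p q pT; nia.
Qed.

Lemma lexrank_inj : injective lexrank.
Proof.
move=> x y xy; have [xy'|yx'|levE] := ltngtP (lev x) (lev y).
- by have := lexrank_lt xy'; rewrite xy ltnn.
- by have := lexrank_lt yx'; rewrite xy ltnn.
have /val_inj : tiebreak x = tiebreak y :> nat.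
  by move: xy; rewrite /lexrank levE; exact: addnI.
by rewrite /tiebreak; case: b => [|/rev_ord_inj]; apply: enum_rank_inj.
Qed.
End Lexicographic.

Lemma lexrank_separates (T : finType) (lev : T -> nat) (x y : T) :
  x != y -> lev y <= lev x -> exists b, lexrank lev b y < lexrank lev b x.
Proof.
move=> xy; rewrite leq_eqVlt => /orP[/eqP levE|yx]; last first.
  by exists true; exact: lexrank_lt.
exists (enum_rank y < enum_rank x); rewrite /lexrank /tiebreak levE ltn_add2l.
have : enum_rank x != enum_rank y by rewrite (inj_eq enum_rank_inj).
rewrite -val_eqE; have := ltn_ord (enum_rank y).
by case: (ltnP (enum_rank y) (enum_rank x)) => //=; lia.
Qed.

(** * Extensions attached to blocks *)

Section Blocks.
Variables (n k : nat).
Hypothesis k_gt0 : 0 < k.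

Definition block (j : nat) : {set 'I_n} := [set i : 'I_n | i %/ k == j].

Lemma card_block j : #|block j| <= k.
Proof.
pose f (i : 'I_n) : 'I_k := Ordinal (ltn_pmod i k_gt0).
rewrite -[leqRHS]card_ord -(card_in_imset (f := f)) ?max_card // => x y.
rewrite !inE => /eqP xj /eqP yj /(congr1 val) /= xy; apply: val_inj => /=.
by rewrite (divn_eq x k) (divn_eq y k) xj yj xy.
Qed.

Let index := (bool + 'I_(n %/ k).+1 * {set 'I_n})%type.

(** The index [inl b] stands for a linear extension of the whole poset, and
    [inr (j, X)] for the extension attached to the block D of number j and to
    the trace X on D. The trace D itself would reverse no pair; excluding it
    keeps the frequency of an atom at 2 ^ k - 1 + 2. *)
Definition ext_ground (p : index) : {set Bn1 n} :=
  match p with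
  | inl _ => [set: Bn1 n]
  | inr (j, X) => [set A : Bn1 n | (X \proper block j) &&
      (if #|A| == 1 then A \subset block j else A :&: block j == X)]
  end.

Definition ext_level (p : index) (A : Bn1 n) : nat :=
  match p with
  | inl _ => #|A| != 1
  | inr (_, X) => if #|A| != 1 then 1 else if A \subset X then 0 else 2
  end.

Definition ext_rank (p : index) : Bn1 n -> nat :=
  lexrank (ext_level p) (if p is inl b then b else true).

Lemma ext_rank_mono p :
  {in ext_ground p &, forall A B, (A <= B)%O -> ext_rank p A <= ext_rank p B}.
Proof.
move=> A B AG BG; case/orP => [/eqP->//|/andP[A1 AB]].
have [->//|neAB] := eqVneq A B; apply/ltnW/lexrank_lt.
have B1 : #|B| != 1.
  apply: contra neAB => B1; apply/eqP/val_inj/eqP.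
  by rewrite eqEcard AB (eqP A1) (eqP B1).
case: p AG BG => [b|[j X]] /=; first by rewrite A1 B1.
rewrite !inE A1 (negbTE B1) /= => /andP[_ Aj] /andP[_ /eqP<-].
by rewrite subsetI AB Aj.
Qed.

(** If the level of B does not exceed that of A, one of the two orders of the
    whole poset already puts B below A. Otherwise A is an atom {a} and B is a
    non-atom avoiding a; the extension that reverses them is the one for the
    block of a and the trace of B on it. *)
Lemma ext_reverses (A B : Bn1 n) : ~~ (A <= B)%O ->
  exists p, [/\ A \in ext_ground p, B \in ext_ground p
              & ext_rank p B < ext_rank p A].
Proof.
move=> nAB.
have [lev|] := leqP (ext_level (inl true) B) (ext_level (inl true) A).
  have neAB : A != B by apply: contraNneq nAB => ->.
  by have [b ?] := lexrank_separates neAB lev; exists (inl b); rewrite !inE.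
rewrite /=; case A1 : (#|A| == 1) => /=; last by case: (#|B| != 1).
case B1 : (#|B| == 1) => //= _.
have /cards1P[a Aa] := A1.
have aB : a \notin (B : {set _}).
  apply: contra nAB => aB.
  by rewrite /Order.le /= /Bn1_le A1 Aa sub1set aB orbT.
have jP : a %/ k < (n %/ k).+1 by rewrite ltnS leq_div2r // ltnW.
pose j := Ordinal jP.
have aj : a \in block j by rewrite inE.
have Xj : B :&: block j \proper block j.
  apply/properP; split; first exact: subsetIr.
  by exists a => //; rewrite inE (negbTE aB).
exists (inr (j, B :&: block j)); rewrite !inE Xj A1 B1 eqxx Aa sub1set aj.
by split=> //; apply: lexrank_lt; rewrite /= A1 B1 Aa sub1set inE (negbTE aB).
Qed.

(** An atom meets a single block, where all proper traces are possible; a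
    non-atom meets every block, with its own trace only. *)
Lemma card_ext_ground (A : Bn1 n) :
  #|[set p | A \in ext_ground p]| <= maxn (2 ^ k).+1 (n %/ k).+3.
Proof.
pose Q := [set q | A \in ext_ground (inr q)].
have -> : [set p | A \in ext_ground p] = inl @: [set: bool] :|: inr @: Q.
  apply/setP => -[b|q]; rewrite !inE.
    by rewrite (imset_f (inl : bool -> index)) ?inE.
  apply/idP/orP => [qA|[/imsetP[//]|/imsetP[q' + [->]]]]; last by rewrite inE.
  by right; apply: imset_f; rewrite inE.
apply: leq_trans (leq_card_setU _ _) _.
rewrite card_imset; last by move=> ? ? [].
rewrite card_imset; last by move=> ? ? [].
rewrite cardsT card_bool.
have [A1|A1] := boolP (#|A| == 1).
  have /cards1P[a Aa] := A1.
  have QS : Q \subset setX [set inord (a %/ k)]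
      (powerset (block (a %/ k)) :\ block (a %/ k)).
    apply/subsetP => -[j X]; rewrite !inE A1 Aa sub1set inE /=.
    move=> /andP[Xj /eqP aj].
    rewrite -val_eqE /= inordK aj ?eqxx ?ltn_ord //=.
    by rewrite (proper_sub Xj) (proper_neq Xj).
  have Q_le := subset_leq_card QS; rewrite cardsX cards1 mul1n in Q_le.
  rewrite leq_max ltnS; apply/orP; left.
  apply: (@leq_trans (2 ^ #|block (a %/ k)|)); last first.
    by rewrite leq_exp2l ?card_block.
  rewrite -card_powerset (cardsD1 (block (a %/ k))) powersetE subxx.
  exact: Q_le.
have Q_inj : {in Q &, injective fst}.
  move=> [j X] [j' X'] /[!inE] /=; rewrite (negbTE A1).
  by move=> /andP[_ /eqP<-] /andP[_ /eqP<-] ->.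
rewrite leq_max; apply/orP; right; rewrite -(card_in_imset Q_inj).
by rewrite !ltnS -[leqRHS]card_ord max_card.
Qed.

Lemma ldim_Bn1_le : ldim (Bn1 n) <= maxn (2 ^ k).+1 (n %/ k).+3.
Proof.
apply: (@ldim_le_of_ranks _ _ _ ext_ground ext_rank).
- by move=> p; exact: lexrank_inj.
- exact: ext_rank_mono.
- by move=> A B; exists (inl true); rewrite !inE.
- exact: ext_reverses.
- exact: card_ext_ground.
Qed.
End Blocks.

(** This is 2 ^ k <= 2 n / m + 2 for k = ceil (m / 2) and the least n whose
    binary logarithm rounds up to m, n = 2 ^ (m - 1) + 1. For m >= 6 it follows
    from m <= 2 ^ (m / 2). *)
Lemma pow2_uphalf_mul_le m : 2 ^ uphalf m * m <= 2 ^ m + 2 * m + 2.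
Proof.
have [|m6] := ltnP m 6; first by move: m; do 6?case=> //.
have half_le : m <= 2 ^ m./2.
  have gen h : 3 <= h -> h.*2.+1 <= 2 ^ h.
    elim: h => // h IH; rewrite leq_eqVlt => /orP[/eqP<-//|h3].
    by have := IH h3; rewrite expnS; lia.
  have := gen m./2; have := odd_double_half m; lia.
apply: (@leq_trans (2 ^ m)); last lia.
have -> : 2 ^ m = 2 ^ uphalf m * 2 ^ m./2.
  rewrite -expnD; congr expn; have := odd_double_half m.
  by rewrite uphalf_half; lia.
by rewrite leq_mul2l half_le orbT.
Qed.

Local Open Scope ring_scope.

(** With 2 ^ (m - 1) < n <= 2 ^ m, it suffices to bound both frequencies by
    2 n / m + 3, since log n <= m: n / k <= 2 n / m because m <= 2 k, and
    2 ^ k <= 2 n / m + 2 is the preceding inequality. *)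
Lemma ldim_Bn1_le_log (R : realType) (n : nat) : (2 <= n)%N ->
  (ldim (Bn1 n))%:R <= 2 * (n%:R / log2 (n%:R : R)) + 3.
Proof.
move=> n_ge2; pose m := up_log 2 n; pose k := uphalf m.
have m_gt0 : (0 < m)%N by rewrite up_log_gt0.
have k_gt0 : (0 < k)%N by rewrite uphalf_gt0.
have n_gt_pow : (2 ^ m.-1 < n)%N by rewrite up_log_gtn.
have n0 : 0 < n%:R :> R by rewrite ltr0n (leq_trans _ n_ge2).
have ln2_gt0 : 0 < ln 2 :> R by rewrite ln_gt0 // ltr1n.
have log_gt0 : 0 < log2 n%:R :> R by rewrite divr_gt0 // ln_gt0 ?ltr1n.
have log_le : log2 n%:R <= m%:R :> R.
  rewrite ler_pdivrMr // mulr_natl -lnXn // ler_ln ?posrE ?exprn_gt0 //.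
  by rewrite -natrX ler_nat up_logP.
have ratio_ge : n%:R / m%:R <= n%:R / log2 n%:R :> R.
  by rewrite ler_pM2l // lef_pV2 // posrE ltr0n.
have m0 : 0 < m%:R :> R by rewrite ltr0n.
have k0 : 0 < k%:R :> R by rewrite ltr0n.
have := ldim_Bn1_le n k_gt0; rewrite -(ler_nat R) => /le_trans; apply.
suff : (maxn (2 ^ k).+1 (n %/ k).+3)%:R <= 2 * (n%:R / m%:R) + 3 :> R by lra.
have [_|_] := leqP (2 ^ k).+1 (n %/ k).+3.
  rewrite -addn3 natrD lerD2r (@le_trans _ _ (n%:R / k%:R)) //.
    by rewrite ler_pdivlMr // -natrM ler_nat leq_divM.
  rewrite mulrA ler_pdivrMr // mulrAC ler_pdivlMr //.
  by rewrite -!natrM ler_nat; rewrite /k uphalf_half; nia.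
suff : (2 ^ k)%:R <= 2 * (n%:R / m%:R) + 2 :> R by rewrite -addn1 natrD; lra.
have -> : 2 * (n%:R / m%:R) + 2 = (2 * n + 2 * m)%:R / m%:R :> R.
  by rewrite natrD !natrM; field; rewrite gt_eqF.
rewrite ler_pdivlMr // -natrM ler_nat.
apply: leq_trans (pow2_uphalf_mul_le m) _.
by move: n_gt_pow; rewrite -[in (2 ^ m)%N](prednK m_gt0) expnS; lia.
Qed.

(** * Encoding sets by least atoms *)

Local Close Scope ring_scope.

Section Encoding.
Variables (n : nat) (I : finType) (F : I -> partial_linext (Bn1 n)).
Hypothesis F_real : local_realizer F.

Definition atom (a : 'I_n) : Bn1 n :=
  MkBn1 (introT (set0Pn _) (ex_intro _ a (set11 a))).

Lemma atom_leE a (A : Bn1 n) : (atom a <= A)%O = (a \in (A : {set _})).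
Proof.
rewrite /Order.le /= /Bn1_le cards1 eqxx /= sub1set.
by case: eqP => // <-; rewrite set11.
Qed.

Lemma notin_reversed a (A : Bn1 n) :
  a \notin (A : {set _}) <-> exists i, ple_lt (F i) A (atom a).
Proof.
rewrite -atom_leE; have [_ F_le] := F_real (atom a) A; split=> [nle|rev].
  apply: boolp.contrapT => nrev; case/negP: nle.
  exact/F_le.
by apply/negP => /F_le.
Qed.

Definition atom_slots : {set 'I_n * I} :=
  [set p | atom p.1 \in ground (F p.2)].

(** The slots of the least atoms above A, in the extensions where A lies below
    some atom. *)
Definition code (A : Bn1 n) : {set 'I_n * I} :=
  [set p | ple_lt (F p.2) A (atom p.1) &&
    [forall c, ple_lt (F p.2) A (atom c) ==>
               ple_le (F p.2) (atom p.1) (atom c)]].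

Lemma code_sub A : code A \subset atom_slots.
Proof.
apply/subsetP => p; rewrite !inE => /andP[/andP[_ Ap] _].
by have [] := ple_le_ground Ap.
Qed.

Lemma card_code A : #|code A| <= frequency F.
Proof.
apply: (@leq_trans (elt_frequency F A)); last exact: leq_bigmax.
have code_inj : {in code A &, injective snd}.
  move=> [a i] [b j]; rewrite !inE /=.
  move=> /andP[Aa /forallP/= a_min] /andP[Ab /forallP/= b_min] ij.
  rewrite -{j}ij in Ab b_min *; congr pair.
  apply/set1_inj/(congr1 (@Bn1_set n) (x := atom a) (y := atom b)).
  apply: (@ple_le_anti _ _ (F i) (atom a) (atom b)).
    exact: (implyP (a_min b)).
  exact: (implyP (b_min a)).
rewrite -(card_in_imset code_inj) subset_leq_card //.
apply/subsetP => _ /imsetP[p + ->]; rewrite !inE => /andP[/andP[_ Ap] _].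
by have [] := ple_le_ground Ap.
Qed.

Lemma card_atom_slots : #|atom_slots| <= n * frequency F.
Proof.
have -> : #|atom_slots| = \sum_(a < n) elt_frequency F (atom a).
  rewrite -sum1_card -(eq_bigl _ _ (fun p => esym (in_set _ p))).
  rewrite (eq_bigl (fun p => true && (atom p.1 \in ground (F p.2)))) //.
  rewrite -(pair_big_dep xpredT (fun a i => atom a \in ground (F i))
    (fun _ _ => 1)) /=.
  apply: eq_bigr => a _; rewrite /elt_frequency -sum1_card.
  by apply: eq_bigl => i; rewrite inE.
rewrite -[n in n * _]card_ord -sum_nat_const.
by apply: leq_sum => a _; exact: leq_bigmax.
Qed.

(** The marks recover the complement of A: if A lies below {a} in an extension,
    then the least atom above A there is marked and is below {a}. *)
Lemma notin_codeP a (A : Bn1 n) :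
  reflect (exists2 p, p \in code A & ple_le (F p.2) (atom p.1) (atom a))
          (a \notin (A : {set _})).
Proof.
apply: (iffP idP) => [/notin_reversed[i Aa]|[[b i] + ba]]; last first.
  rewrite !inE => /andP[/andP[neAb Ab] _] /=; apply/notin_reversed; exists i.
  rewrite /ple_lt (ple_le_trans Ab ba) andbT; apply: contraNneq neAb => Ea.
  by apply/eqP; apply: (ple_le_anti Ab); rewrite Ea.
(* The least atom above A has the smallest down-set. *)
pose down c := [set d | ple_le (F i) (atom d) (atom c)].
have [b Ab b_min] := @arg_minnP _ a (fun c => ple_lt (F i) A (atom c))
  (fun c => #|down c|) Aa.
have b_least c : ple_lt (F i) A (atom c) -> ple_le (F i) (atom b) (atom c).
  move=> Ac; have bG := (ple_le_ground (andP Ab).2).2.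
  have cG := (ple_le_ground (andP Ac).2).2.
  have /orP[//|cb] := ple_le_total bG cG.
  have /eqP down_eq : down c == down b.
    rewrite eqEcard b_min // andbT; apply/subsetP => d; rewrite !inE => dc.
    exact: ple_le_trans dc cb.
  have : b \in down b by rewrite inE ple_le_refl.
  by rewrite -down_eq inE.
exists (b, i); last exact: b_least.
by rewrite inE Ab; apply/forallP => c; apply/implyP/b_least.
Qed.

Lemma code_inj : injective code.
Proof.
move=> A B AB; apply/val_inj/setP => a; apply: negb_inj.
by apply/notin_codeP/notin_codeP; rewrite AB.
Qed.

Lemma card_Bn1_le_small_subsets :
  #|{: Bn1 n}| <=
    #|[set U : {set 'I_n * I} | U \subset atom_slots & #|U| <= frequency F]|.
Proof.
rewrite -(card_imset _ code_inj) subset_leq_card //.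
by apply/subsetP => _ /imsetP[A _ ->]; rewrite inE code_sub card_code.
Qed.
End Encoding.

Lemma card_Bn1 n : #|{: Bn1 n}| = (2 ^ n).-1.
Proof.
rewrite card_sub -[n in RHS]card_ord -cardsT -card_powerset powersetT cardsT.
by rewrite -(cardC1 set0).
Qed.

(** * Counting small subsets *)

Local Open Scope ring_scope.

Lemma sum_expr_card (R : comPzSemiRingType) (T : finType)
    (N : {set T}) (x : R) :
  \sum_(U : {set T} | U \subset N) x ^+ #|U| = (x + 1) ^+ #|N|.
Proof.
rewrite (partition_big (fun U : {set T} => inord #|U| : 'I_#|N|.+1) xpredT) //=.
rewrite exprDn.
rewrite [RHS](reindex_inj rev_ord_inj).
apply: eq_bigr => i _.
rewrite (eq_bigl [in [set U : {set T} | U \subset N & #|U| == i]]); last first.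
  move=> U; rewrite !inE; case UN : (U \subset N) => //=.
  by rewrite -val_eqE /= inordK ?ltnS ?subset_leq_card.
rewrite (eq_bigr (fun=> x ^+ i)); last first.
  by move=> U; rewrite inE => /andP[_ /eqP->].
have iN : (i <= #|N|)%N by rewrite -ltnS.
by rewrite sumr_const cards_draws expr1n mulr1 /= subSS subKn // bin_sub.
Qed.

(** Give a set U the weight n ^- |U|. All subsets of N together weigh
    (1 + 1 / n) ^ |N| <= e ^ t, while each of those counted here weighs at least
    n ^- t. *)
Lemma card_small_subsets (R : realType) (T : finType) (N : {set T})
    (n t : nat) :
  (0 < n)%N -> (#|N| <= n * t)%N ->
  #|[set U : {set T} | U \subset N & (#|U| <= t)%N]|%:R
    <= (n%:R * expR 1) ^+ t :> R.
Proof.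
move=> n_gt0 Nnt; have n0 : 0 < n%:R :> R by rewrite ltr0n.
have n1 : n%:R^-1 <= 1 :> R by rewrite invf_le1 // ler1n.
have n1' : 0 <= n%:R^-1 :> R by rewrite invr_ge0 ltW.
have sum_le :
    #|[set U : {set T} | U \subset N & (#|U| <= t)%N]|%:R * n%:R^-1 ^+ t <=
    (n%:R^-1 + 1) ^+ #|N| :> R.
  rewrite -sum_expr_card -sumr_const big_distrl /=.
  rewrite [leRHS](bigID (fun U : {set T} => #|U| <= t)%N) /=.
  apply: ler_wpDr; first by apply: sumr_ge0 => U _; rewrite exprn_ge0.
  rewrite (eq_bigl (fun U : {set T} => (U \subset N) && (#|U| <= t)%N)).
    by apply: ler_sum => U /andP[_ Ut]; rewrite mul1r ler_wiXn2l.
  by move=> U; rewrite inE.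
rewrite exprMn mulrC -ler_pdivrMr ?exprn_gt0 // -exprVn.
apply: le_trans sum_le _.
apply: (@le_trans _ _ ((n%:R^-1 + 1) ^+ (n * t))).
  by rewrite ler_weXn2l // lerDr.
rewrite exprM lerXn2r ?nnegrE ?exprn_ge0 ?addr_ge0 ?expR_ge0 //.
have -> : expR 1 = expR n%:R^-1 ^+ n :> R.
  by rewrite -expRM_natr mulVf // gt_eqF.
by rewrite lerXn2r ?nnegrE ?addr_ge0 ?expR_ge0 // addrC expR_ge1Dx.
Qed.

Lemma card_Bn1_le_expR (R : realType) (n : nat) : (0 < n)%N ->
  (2 ^ n).-1%:R <= (n%:R * expR 1) ^+ ldim (Bn1 n) :> R.
Proof.
move=> n_gt0; rewrite /ldim; case: ex_minnP => t /asboolP[I [F [F_real <-]]] _.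
apply: le_trans (card_small_subsets R n_gt0 (card_atom_slots F)).
by rewrite ler_nat -card_Bn1 (card_Bn1_le_small_subsets F_real).
Qed.

(** * Asymptotics of the lower bound *)

Local Open Scope classical_set_scope.

(** The o(1) of the lower bound: (1 - ldim_loss n) n / log n equals
    (n - 1) ln 2 / (ln n + 1). *)
Definition ldim_loss (R : realType) (n : nat) : R :=
  1 - (1 - n%:R^-1) * (1 - (ln n%:R + 1)^-1).

Lemma cvg_inv_ln_add1 (R : realType) :
  (ln (n%:R : R) + 1)^-1 @[n --> \oo] --> (0 : R).
Proof.
have ln_cvg : (ln (n%:R : R) + 1) @[n --> \oo] --> +oo.
  apply/cvgryPge => A; near=> n.
  have An : expR A <= n%:R by near: n; exact: nbhs_infty_ger.
  have n0 : 0 < n%:R :> R := lt_le_trans (expR_gt0 A) An.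
  by rewrite ler_wpDr // -ler_expR lnK.
apply/(gtr0_cvgV0 _).2 => //.
near=> n; have n1 : 1 <= n%:R :> R by near: n; exact: nbhs_infty_ger.
by rewrite ltr_wpDl ?ln_ge0.
Unshelve. all: by end_near.
Qed.

Lemma cvg_ldim_loss (R : realType) : ldim_loss R n @[n --> \oo] --> (0 : R).
Proof.
have inv_cvg : (n%:R^-1 : R) @[n --> \oo] --> (0 : R).
  by rewrite -(cvg_shiftS (fun n => n%:R^-1 : R)); exact: cvg_harmonic.
have : ldim_loss R n @[n --> \oo] --> 1 - (1 - 0) * (1 - 0 : R).
  apply: cvgB; first exact: cvg_cst.
  apply: cvgM; apply: cvgB => //; [exact: cvg_cst|exact: cvg_cst|].
  exact: cvg_inv_ln_add1.
by rewrite !subr0 mulr1 subrr.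
Qed.

Lemma ldim_Bn1_ge_log (R : realType) (n : nat) : (2 <= n)%N ->
  (1 - ldim_loss R n) * (n%:R / log2 n%:R) <= (ldim (Bn1 n))%:R.
Proof.
move=> n_ge2; have n_gt0 : (0 < n)%N := ltnW n_ge2.
have n0 : 0 < n%:R :> R by rewrite ltr0n.
have ln2_gt0 : 0 < ln 2 :> R by rewrite ln_gt0 // ltr1n.
have ln_gt0 : 0 < ln n%:R :> R by rewrite ln_gt0 ?ltr1n.
have ln1_gt0 : 0 < ln n%:R + 1 :> R by rewrite ltr_wpDr.
have -> : (1 - ldim_loss R n) * (n%:R / log2 n%:R)
    = n.-1%:R * ln 2 / (ln n%:R + 1).
  rewrite /ldim_loss /log2 -subn1 natrB //.
  by field; rewrite !gt_eqF.
have pow_le : 2 ^+ n.-1 <= (n%:R * expR 1) ^+ ldim (Bn1 n) :> R.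
  apply: le_trans (card_Bn1_le_expR R n_gt0).
  rewrite -natrX ler_nat -{2}(prednK n_gt0) expnS.
  by have : (0 < 2 ^ n.-1)%N; [rewrite expn_gt0 | lia].
rewrite ler_pdivrMr // !mulr_natl.
have -> : ln n%:R + 1 = ln (n%:R * expR 1) :> R.
  by rewrite lnM ?posrE ?expR_gt0 // expRK.
rewrite -!lnXn ?mulr_gt0 ?expR_gt0 //.
by rewrite ler_ln ?posrE ?exprn_gt0 ?mulr_gt0 ?expR_gt0.
Qed.

Theorem theorem2 (R : realType) :
  exists o1 : nat -> R,
    (o1 n @[n --> \oo] --> (0 : R)) /\
    (forall n : nat, (2 <= n)%N ->
      (1 - o1 n) * (n%:R / log2 n%:R) <= (ldim (Bn1 n))%:R /\
      (ldim (Bn1 n))%:R <= 2 * (n%:R / log2 (n%:R : R)) + 3).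
Proof.
exists (ldim_loss R); split; first exact: cvg_ldim_loss.
by move=> n n_ge2; split; [exact: ldim_Bn1_ge_log | exact: ldim_Bn1_le_log].
Qed.
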